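(* Let $A$ be a bounded prime dissipative operator with a rank one imaginary part acting in a separable Hilbert space $\mathcal{H}$. Suppose that the characteristic function $W(z)$ of $A$ satisfies $$W(-z)=\frac{1}{W(z)},\qquad |z|>\|A\|.$$ Then the bounded Jacobi matrix corresponding to $A$, with diagonal entries $b_1,b_2,\ldots$ and off-diagonal entries $a_1,a_2,\ldots$ satisfying $\operatorname{Im}b_1>0$, $b_k\in\mathbb{R}$ for $k\ge2$, $a_k>0$ for all $k$, possesses the property $$\operatorname{Re}b_1=b_2=b_3=\cdots=0.$$
   Context: For a bounded operator $A$ put $A_I=\frac{A-A^*}{2i}$. $A$ is dissipative if $A_I\ge0$, has a rank one imaginary part if $\operatorname{rank}A_I=1$, and is prime if there is no nonzero reducing subspace of $A$ on which $A$ is self-adjoint. If $g$ is a vector with $2A_Ih=(h,g)g$ for all $h$, the characteristic function of $A$ is $W(z)=1-i((A-zI)^{-1}g,g)$, $z\in\rho(A)$. A Jacobi matrix with entries $b_k,a_k$ is the ($n\times n$ or semi-infinite) tri-diagonal matrix with $b_k$ in position $(k,k)$ and $a_k$ in positions $(k,k+1)$ and $(k+1,k)$; it is bounded if $\sup_k\{|a_k|+|b_k|\}<\infty$. A bounded Jacobi matrix with $\operatorname{Im}b_1>0$, $b_k\in\mathbb{R}$ ($k\ge2$), $a_k>0$ is said to correspond to $A$ if it is the matrix of $A$ in some orthonormal basis of $\mathcal{H}$ (equivalently, the operator it defines in $\mathbb{C}^n$ or $l_2(\mathbb{N})$ is unitarily equivalent to $A$). It is a fact that every bounded prime dissipative operator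 with a rank one imaginary part has such a corresponding Jacobi matrix. *)

(* Defs.v *)
From HB Require Import structures.
From mathcomp Require Import all_boot all_order all_algebra.
From mathcomp Require Import complex.
From mathcomp Require Import all_classical all_reals all_analysis.

Set Implicit Arguments.
Unset Strict Implicit.
Unset Printing Implicit Defensive.

Import Order.TTheory GRing.Theory Num.Theory.
Import numFieldNormedType.Exports.

Local Open Scope classical_set_scope.
Local Open Scope ring_scope.

(* A complex Hilbert space is a Banach space H over R[i] with an inner product
   dot : {dot H for Num.conj}, linear in its first argument and conjugate-linear
   in its second, whose associated norm is the norm of H.  On R[i], 0 <= z means
   that z is real and nonnegative. *)
Definition hilbert_norm (R : realType) (H : normedModType R[i])
    (dot : {dot H for Num.conj}) : Prop :=
  forall x : H, `|x| ^+ 2 = dot x x.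

Definition separable_space (T : topologicalType) : Prop :=
  exists2 D : set T, countable D & dense D.

Section Operators.
Variables (R : realType) (H : normedModType R[i]).
Implicit Types T : H -> H.

Definition bounded_operator T : Prop :=
  exists M : R[i], forall x, `|T x| <= M * `|x|.

(* Norms live in R[i]; the real part brings them back to R, where sup exists. *)
Definition operator_norm T : R :=
  sup [set complex.Re `|T x| | x in [set x : H | `|x| <= 1]].

Definition bounded_inverse T : set (H -> H) :=
  [set S | [/\ bounded_operator S, cancel T S & cancel S T]].

Definition resolvent_set T : set R[i] :=
  [set z | bounded_inverse (fun x => T x - z *: x) !=set0].

Definition resolvent T (z : R[i]) : H -> H :=
  xget (fun=> 0) (bounded_inverse (fun x => T x - z *: x)).

Definition closed_subspace (M : set H) : Prop :=
  [/\ M 0, (forall (c : R[i]) x y, M x -> M y -> M (c *: x + y)) & closed M].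

Definition invariant_under T (M : set H) : Prop := forall x, M x -> M (T x).

Variable dot : {dot H for Num.conj}.

(* By the Riesz theorem every bounded linear T on a Hilbert space has exactly
   one such adjoint. *)
Definition adjoint T : H -> H :=
  xget (fun=> 0) [set S : H -> H | forall x y, dot (T x) y = dot x (S y)].

Definition imaginary_part T (x : H) : H := (2 * 'i)^-1 *: (T x - adjoint T x).

Definition dissipative T : Prop := forall x, 0 <= dot (imaginary_part T x) x.

Definition rank_one T : Prop :=
  exists2 u : H, u != 0 & range T = range (fun c : R[i] => c *: u).

Definition orthogonal_complement (M : set H) : set H :=
  [set y | forall x, M x -> dot y x = 0].

Definition reducing T (M : set H) : Prop :=
  [/\ closed_subspace M, invariant_under T M
    & invariant_under T (orthogonal_complement M)].

Definition selfadjoint_on T (M : set H) : Prop :=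
  forall x y, M x -> M y -> dot (T x) y = dot x (T y).

Definition prime_operator T : Prop :=
  ~ exists M : set H, [/\ reducing T M, M != [set 0] & selfadjoint_on T M].

Definition channel_vector T (g : H) : Prop :=
  forall h, 2 *: imaginary_part T h = dot h g *: g.

(* Meaningful for z in resolvent_set T. *)
Definition characteristic_function T (g : H) (z : R[i]) : R[i] :=
  1 - 'i * dot (resolvent T z g) g.

End Operators.

(* Some n encodes an n x n matrix (indices 0, ..., n-1), None a semi-infinite
   one.  Indices start at 0, so b k and a k are the entries usually written
   b_(k+1) and a_(k+1). *)
Definition index_lt (N : option nat) (k : nat) : bool :=
  if N is Some n then (k < n)%N else true.

Section Jacobi.
Variables (R : realType) (N : option nat).
Implicit Types b a : nat -> R[i].

Definition jacobi_entry b a (j k : nat) : R[i] :=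
  if j == k then b k
  else if k == j.+1 then a j
  else if j == k.+1 then a k
  else 0.

(* In an n x n matrix a (n-1) is not an entry; the bound is harmless there,
   since it then ranges over finitely many k. *)
Definition jacobi_bounded b a : Prop :=
  exists M : R[i], forall k, index_lt N k -> `|a k| + `|b k| <= M.

Definition jacobi_admissible b a : Prop :=
  [/\ 0 < 'Im (b 0%N),
      (forall k, (0 < k)%N -> index_lt N k -> b k \is Num.real)
    & (forall k, index_lt N k.+1 -> 0 < a k)].

Definition finite_span (H : lmodType R[i]) (e : nat -> H) : set H :=
  [set x | exists (m : nat) (c : nat -> R[i]),
     x = \sum_(k < m | index_lt N k) c k *: e k].

Definition orthonormal_basis (H : normedModType R[i])
    (dot : {dot H for Num.conj}) (e : nat -> H) : Prop :=
  (forall j k, index_lt N j -> index_lt N k -> dot (e j) (e k) = (j == k)%:R) /\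
  closure (finite_span e) = setT.

Definition is_matrix_of (H : normedModType R[i]) (dot : {dot H for Num.conj})
    (T : H -> H) (e : nat -> H) (m : nat -> nat -> R[i]) : Prop :=
  forall j k, index_lt N j -> index_lt N k -> dot (T (e k)) (e j) = m j k.

Definition jacobi_corresponds (H : normedModType R[i])
    (dot : {dot H for Num.conj}) (T : H -> H) b a : Prop :=
  [/\ jacobi_bounded b a, jacobi_admissible b a
    & exists2 e : nat -> H, orthonormal_basis dot e
                          & is_matrix_of dot T e (jacobi_entry b a)].

End Jacobi.

(* Main.v *)
(* The vector g is a multiple c e_0 of the first basis vector, with
   i |c|^2 = b_0 - conj b_0, so the coefficients u_j(z) = ((A - z)^-1 g, e_j)
   satisfy the three-term recurrence of the matrix with source c at j = 0.
   Multiplying the recurrence of u_j = u_j(z) by v_j = u_j(-z),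
   that of v_j by u_j, and adding, one gets for
   w_j = a_j (u_j v_(j+1) + u_(j+1) v_j) the relations
     w_(j-1) + 2 b_j u_j v_j + w_j = 0 for j > 0,
     2 b_0 u_0 v_0 + w_0 = c (u_0 + v_0),
   and W(z) W(-z) = 1 says exactly that c (u_0 + v_0) = i |c|^2 u_0 v_0.
   As z tends to infinity, u_j(z) z^(j+1) has a nonzero limit, so u_j v_j has
   exact order z^(-2j-2) while w_j = O(z^(-2j-3)).  Hence Re b_0 = 0 and
   w_0 = 0, then b_1 = 0 and w_1 = 0, and so on. *)
Require Import Defs.
From HB Require Import structures.
From mathcomp Require Import all_boot all_order all_algebra.
From mathcomp Require Import ring.
From mathcomp Require Import complex.
From mathcomp Require Import all_classical all_reals all_analysis.

Set Implicit Arguments.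
Unset Strict Implicit.
Unset Printing Implicit Defensive.

Import Order.TTheory GRing.Theory Num.Theory.
Import numFieldNormedType.Exports.

Local Open Scope classical_set_scope.
Local Open Scope ring_scope.

(** * Orders of decay along a sequence of points *)

(** This encodes f = O(1/z^m) along one sequence of points, with a bound for every [n], so that
    asymptotics become plain inequalities. *)
Definition inv_bigO (K : numFieldType) (z : nat -> K) (m : nat)
    (f : nat -> K) : Prop :=
  exists C : K, forall n, `|f n * z n ^+ m| <= C.

Section InvBigO.
Variables (K : numFieldType) (z : nat -> K).
Implicit Types (f g : nat -> K) (m : nat).

Lemma eq_inv_bigO m f g : f =1 g -> inv_bigO z m f -> inv_bigO z m g.
Proof. by move=> fg [C hC]; exists C => n; rewrite -fg. Qed.

Lemma inv_bigO0 m : inv_bigO z m (fun=> 0).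
Proof. by exists 0 => n; rewrite mul0r normr0. Qed.

Lemma inv_bigOD m f g : inv_bigO z m f -> inv_bigO z m g ->
  inv_bigO z m (fun n => f n + g n).
Proof.
move=> [C hC] [D hD]; exists (C + D) => n.
by rewrite mulrDl (le_trans (ler_normD _ _))// lerD.
Qed.

Lemma inv_bigOZ m (c : K) f : inv_bigO z m f ->
  inv_bigO z m (fun n => c * f n).
Proof.
move=> [C hC]; exists (`|c| * C) => n.
by rewrite -mulrA normrM ler_wpM2l.
Qed.

Lemma inv_bigOM m p f g : inv_bigO z m f -> inv_bigO z p g ->
  inv_bigO z (m + p) (fun n => f n * g n).
Proof.
move=> [C hC] [D hD]; exists (C * D) => n.
by rewrite exprD mulrACA normrM ler_pM.
Qed.

Lemma inv_bigO_mulz m f : inv_bigO z m (fun n => z n * f n) <->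
  inv_bigO z m.+1 f.
Proof.
by split=> -[C hC]; exists C => n; move: (hC n);
  rewrite exprS mulrA (mulrC (z n)).
Qed.

Lemma inv_bigO_mulzX m p f : inv_bigO z (m + p) f ->
  inv_bigO z m (fun n => f n * z n ^+ p).
Proof. by move=> [C hC]; exists C => n; rewrite -mulrA -exprD addnC. Qed.

Lemma inv_bigON m f : inv_bigO (fun n => - z n) m f -> inv_bigO z m f.
Proof.
move=> [C hC]; exists C => n; move: (hC n).
by rewrite !normrM !normrX normrN.
Qed.

Hypothesis z_ge1 : forall n, 1 <= `|z n|.

Lemma inv_bigO_le m p f : (m <= p)%N -> inv_bigO z p f -> inv_bigO z m f.
Proof.
move=> lemp [C hC]; exists C => n; apply: le_trans (hC n).
by rewrite !normrM ler_wpM2l// !normrX ler_weXn2l.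
Qed.

Hypothesis z_unbounded : forall C : K, 0 <= C -> exists n, C < `|z n|.

(** This is where decay turns into an exact equality: for [r] nonzero, the products [r * z n] would
    be unbounded. *)
Lemma inv_bigO_cst (r : K) : inv_bigO z 1 (fun=> r) -> r = 0.
Proof.
move=> [C hC]; apply/eqP/negPn/negP => r0.
have C0 : 0 <= C := le_trans (normr_ge0 _) (hC 0%N).
have [n] := z_unbounded (divr_ge0 C0 (normr_ge0 r)).
rewrite ltr_pdivrMr ?normr_gt0// mulrC -normrM => /lt_le_trans-/(_ _ (hC n)).
by rewrite ltxx.
Qed.

End InvBigO.

(** * Three-term recurrences and their asymptotics *)

Definition jacobi_row (K : pzRingType) (b a : nat -> K) (y : nat -> K)
    (j : nat) : K :=
  (if j is i.+1 then a i * y i else 0) + b j * y j + a j * y j.+1.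

Section JacobiResolvent.
Variables (K : numFieldType) (V : pred nat) (b a : nat -> K) (c : K).

(* V is the set of indices of the matrix: a finite matrix is handled by
   extending coefficients by 0. *)
Definition jacobi_resolvent (z : nat -> K) (x : nat -> nat -> K) : Prop :=
  (forall j n, V j ->
     z n * x j n + (j == 0%N)%:R * c = jacobi_row b a (x^~ n) j) /\
  (forall j n, ~~ V j -> x j n = 0).

Section Asymptotics.
Variables (z : nat -> K) (x : nat -> nat -> K).
Hypothesis z_ge1 : forall n, 1 <= `|z n|.
Hypothesis x_res : jacobi_resolvent z x.
Hypothesis x_O1 : forall j, inv_bigO z 1 (x j).

(** Rows of positive index have no source, so [z] times entry i+1 combines entries i, i+1 and i+2. A
    bound of order m+1 on all entries from index m on thus gains one order from index m+1 on. *)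
Lemma jacobi_resolvent_bigO j : inv_bigO z j.+1 (x j).
Proof.
suff H m : forall i, (m <= i)%N -> inv_bigO z m.+1 (x i) by exact: H.
elim: m => [i _|m IH [//|i]]; first exact: x_O1.
rewrite ltnS => mi.
have [Vi|Vi] := boolP (V i.+1); last first.
  by apply: eq_inv_bigO (inv_bigO0 _ _) => n; rewrite x_res.2.
apply/inv_bigO_mulz.
have := inv_bigOD (inv_bigOD (inv_bigOZ (a i) (IH _ mi))
  (inv_bigOZ (b i.+1) (IH _ (leqW mi))))
  (inv_bigOZ (a i.+1) (IH _ (leqW (leqW mi)))).
by apply: eq_inv_bigO => n; have := x_res.1 _ n Vi; rewrite mul0r addr0 => ->.
Qed.

Hypothesis V_down : forall j, V j.+1 -> V j.
Hypothesis a_neq0 : forall j, V j.+1 -> a j != 0.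
Hypothesis c_neq0 : c != 0.

(** Row 0 gives the leading coefficient [- c], and each further row multiplies it by [a j]; none of
    these factors is zero. *)
Lemma jacobi_resolvent_lead j : V j ->
  exists2 L : K, L != 0 & inv_bigO z 1 (fun n => x j n * z n ^+ j.+1 - L).
Proof.
elim: j => [|j IH] Vj.
  exists (- c); first by rewrite oppr_eq0.
  have O2 : inv_bigO z 1 (fun n => b 0%N * x 0%N n + a 0%N * x 1%N n).
    by apply: inv_bigOD; apply: inv_bigOZ.
  apply: eq_inv_bigO O2 => n; have := x_res.1 _ n Vj.
  by rewrite /jacobi_row mul1r add0r => <-; rewrite opprK expr1 mulrC.
have [L L0 OL] := IH (V_down Vj).
exists (a j * L); first by rewrite mulf_neq0 ?a_neq0.
(* The diagonal and right-hand terms have order j+2, so they remain O(1/z) after multiplication by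
   z^(j+1). *)
have O2 : inv_bigO z j.+2 (fun n => b j.+1 * x j.+1 n + a j.+1 * x j.+2 n).
  apply: inv_bigOD; apply: inv_bigOZ; first exact: jacobi_resolvent_bigO.
  by apply: inv_bigO_le (jacobi_resolvent_bigO _).
have := inv_bigOD (inv_bigOZ (a j) OL) (@inv_bigO_mulzX _ z 1 j.+1 _ O2).
apply: eq_inv_bigO => n; have := x_res.1 _ n Vj.
rewrite /jacobi_row mul0r addr0 -addrA => /esym/(canRL (addKr _)) ->.
by rewrite [in RHS]exprS; ring.
Qed.

End Asymptotics.

Hypothesis V_down : forall j, V j.+1 -> V j.
Hypothesis a_neq0 : forall j, V j.+1 -> a j != 0.
Hypothesis c_neq0 : c != 0.

Variables (z : nat -> K) (u v : nat -> nat -> K) (s : K).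
Hypothesis z_ge1 : forall n, 1 <= `|z n|.
Hypothesis z_unbounded : forall C : K, 0 <= C -> exists n, C < `|z n|.
Hypothesis u_res : jacobi_resolvent z u.
Hypothesis v_res : jacobi_resolvent (fun n => - z n) v.
Hypothesis u_O1 : forall j, inv_bigO z 1 (u j).
Hypothesis v_O1 : forall j, inv_bigO z 1 (v j).
Hypothesis uv_s : forall n, c * (u 0%N n + v 0%N n) = s * (u 0%N n * v 0%N n).

Let w j n := a j * (u j n * v j.+1 n + u j.+1 n * v j n).

(** The order 2j+3 exceeds by one that of [u j * v j]; [coef_eq0] rests on this gap. *)
Let w_bigO j : inv_bigO z (j + j).+3 (w j).
Proof.
have Ou i := jacobi_resolvent_bigO u_res u_O1 i.
have Ov i : inv_bigO z i.+1 (v i).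
  apply: inv_bigON; apply: jacobi_resolvent_bigO v_res _ i => i.
  by case: (v_O1 i) => C hC; exists C => n; rewrite mulrN normrN.
apply: inv_bigOZ; apply: inv_bigOD.
  by have := inv_bigOM (Ou j) (Ov j.+1); rewrite !addnS !addSn.
by have := inv_bigOM (Ou j.+1) (Ov j); rewrite !addnS !addSn.
Qed.

(** After scaling by z^(2j+2), the left side tends to [r] times a nonzero constant, up to sign,
    while the right side is O(1/z). *)
Let coef_eq0 j (r : K) : V j -> (forall n, r * (u j n * v j n) = w j n) ->
  r = 0.
Proof.
move=> Vj rw.
have [L L0 OL] := jacobi_resolvent_lead z_ge1 u_res u_O1 V_down a_neq0
  c_neq0 Vj.
have zN n : 1 <= `|- z n| by rewrite normrN.
have v_O1N i : inv_bigO (fun n => - z n) 1 (v i).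
  by case: (v_O1 i) => C hC; exists C => n; rewrite mulrN normrN.
have [M M0 OM] := jacobi_resolvent_lead zN v_res v_O1N V_down a_neq0 c_neq0 Vj.
have {}OM := inv_bigON OM.
pose U n := u j n * z n ^+ j.+1; pose W n := v j n * (- z n) ^+ j.+1.
(* The sign arises because [v] is expanded in powers of [- z n]. *)
have Ow : inv_bigO z 1 (fun n => (-1) ^+ j.+1 * (w j n * z n ^+ (j + j).+2)).
  by apply: inv_bigOZ; apply: inv_bigO_mulzX; exact: w_bigO.
have OrUW : inv_bigO z 1 (fun n => r * (U n * W n)).
  apply: eq_inv_bigO Ow => n; rewrite -rw /U /W (exprNn (z n)).
  by rewrite -addnS -addSn exprD; ring.
have OULW : inv_bigO z 1 (fun n => r * ((U n - L) * (W n - M))).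
  apply: inv_bigOZ; apply: (inv_bigO_le z_ge1 (leqnSn 1)).
  exact: inv_bigOM OL OM.
(* LM = UW - (U-L)(W-M) - L(W-M) - M(U-L), and each term on the right, times [r], is O(1/z). *)
have : inv_bigO z 1 (fun=> r * L * M).
  have := inv_bigOD OrUW (inv_bigOD (inv_bigOZ (-1) OULW)
    (inv_bigOD (inv_bigOZ (- r * L) OM) (inv_bigOZ (- r * M) OL))).
  by apply: eq_inv_bigO => n; rewrite -/(U n) -/(W n); ring.
move/(inv_bigO_cst z_unbounded)/eqP.
by rewrite !mulf_eq0 (negPf L0) (negPf M0) !orbF => /eqP.
Qed.

(** The spectral terms [z n * u j n * v j n] and [- z n * v j n * u j n] cancel in the sum. *)
Let row_uv j n : V j ->
  (j == 0%N)%:R * c * (u j n + v j n) =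
  (if j is i.+1 then w i n else 0) + b j *+ 2 * (u j n * v j n) + w j n.
Proof.
move=> Vj; have hu := u_res.1 _ n Vj; have hv := v_res.1 _ n Vj.
transitivity (jacobi_row b a (u^~ n) j * v j n +
              jacobi_row b a (v^~ n) j * u j n).
  by rewrite -hu -hv; ring.
by rewrite /jacobi_row /w; case: j {Vj hu hv} => [|i]; ring.
Qed.

(** With [s] equal to [b 0] minus its conjugate, the first conclusion says that [b 0] has zero real
    part. *)
Lemma jacobi_odd_diag :
  (V 0%N -> b 0%N *+ 2 = s) /\ (forall k, (0 < k)%N -> V k -> b k = 0).
Proof.
have w0 n : V 0%N -> (s - b 0%N *+ 2) * (u 0%N n * v 0%N n) = w 0%N n.
  by move=> V0; rewrite mulrBl -uv_s; have := row_uv n V0;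
    rewrite mul1r => ->; ring.
have b0 : V 0%N -> s - b 0%N *+ 2 = 0.
  by move=> V0; apply: (coef_eq0 V0) => n; exact: w0.
have wS k n : V k.+1 -> w k n = 0 ->
    - (b k.+1 *+ 2) * (u k.+1 n * v k.+1 n) = w k.+1 n.
  move=> Vk wk; have := row_uv n Vk; rewrite mul0r mul0r wk add0r.
  by move/esym/eqP; rewrite addrC addr_eq0 mulNr => /eqP.
(* The induction carries [w k = 0]: it reduces row k+1 to the form [coef_eq0] accepts, which kills
   [b k.+1] and hence [w k.+1]. *)
have w_eq0 k : V k -> forall n, w k n = 0.
  elim: k => [|k IH] Vk n; first by rewrite -w0// b0// mul0r.
  have wk := IH (V_down Vk).
  rewrite -wS//; have -> : - (b k.+1 *+ 2) = 0; last by rewrite mul0r.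
  by apply: (coef_eq0 Vk) => m; exact: wS.
split=> [V0|[//|k] _ Vk]; first by apply/eqP; rewrite eq_sym -subr_eq0 b0.
have /eqP : - (b k.+1 *+ 2) = 0.
  by apply: (coef_eq0 Vk) => m; apply: wS => //; apply: w_eq0; exact: V_down.
by rewrite oppr_eq0 mulrn_eq0 => /eqP.
Qed.

End JacobiResolvent.

(** * Existence and size of the resolvent far from the origin *)

(** In the partial order of [R[i]], [0 <= C] forces [C] to be real, so the Archimedean property of
    [R] applies. *)
Lemma complex_lt_nat (R : realType) (C : R[i]) : 0 <= C ->
  exists n : nat, C < n%:R.
Proof.
case: C => x y; rewrite lecE /= => /andP[/eqP -> x0].
exists (Num.truncn x).+1.
by rewrite -(rmorph_nat (real_complex R)) ltcR truncnS_gt.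
Qed.

Lemma contraction_fixpoint (R : realType) (H : completeNormedModType R[i])
    (F : H -> H) :
  (forall x y, `|F x - F y| <= 2^-1 * `|x - y|) -> exists p, F p = p.
Proof.
move=> ctrF; pose y n := iter n F 0; pose D := `|y 1%N - y 0%N|.
have D0 : 0 <= D *+ 2 by rewrite mulrn_wge0 /D.
have step n : `|y n.+1 - y n| <= D * 2^-1 ^+ n.
  elim: n => [|n IH]; first by rewrite mulr1.
  apply: le_trans (ctrF _ _) _.
  by rewrite exprS mulrCA ler_wpM2l// invr_ge0.
(* The second summand on the left is the rest of the geometric series; carrying it makes the
   induction close. *)
have tail n m :
    `|y (n + m)%N - y n| + D *+ 2 * 2^-1 ^+ (n + m) <= D *+ 2 * 2^-1 ^+ n.
  elim: m => [|m IH]; first by rewrite addn0 subrr normr0 add0r.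
  apply: le_trans IH; rewrite addnS.
  rewrite (le_trans (lerD (ler_distD (y (n + m)%N) _ _) (lexx _)))//.
  rewrite addrAC addrC lerD2l.
  rewrite (le_trans (lerD (step _) (lexx _)))// exprS.
  suff -> : D * 2^-1 ^+ (n + m) + D *+ 2 * (2^-1 * 2^-1 ^+ (n + m)) =
            D *+ 2 * 2^-1 ^+ (n + m) by [].
  by field.
have small (e : R[i]) : 0 < e ->
    exists n, forall m, (n <= m)%N -> `|y m - y n| < e.
  move=> e0; have [n hn] := complex_lt_nat (divr_ge0 D0 (ltW e0)).
  (* An [n] above 2D/e is large enough because n < 2^n. *)
  exists n => m nm; rewrite -(subnKC nm).
  apply: le_lt_trans (_ : D *+ 2 * 2^-1 ^+ n < e).
    apply: le_trans (tail n (m - n)%N); rewrite lerDl.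
    by rewrite mulr_ge0// exprn_ge0// invr_ge0.
  move: hn; rewrite exprVn ltr_pdivrMr// ltr_pdivrMr ?exprn_gt0//.
  move/lt_le_trans; apply.
  by rewrite mulrC ler_wpM2l ?(ltW e0)// -natrX ler_nat ltnW// ltn_expl.
have /cauchy_cvgP/cvg_ex[p yp] : cauchy (y @ \oo).
  apply: cauchy_exP => e e0; have [n hn] := small e e0.
  exists (y n); exists n => // m /= nm.
  by rewrite -ball_normE /= distrC hn.
exists p; apply/eqP; rewrite -subr_eq0 -normr_eq0.
apply/negPn/negP => N0.
have e0 : 0 < `|F p - p| / 2 by rewrite divr_gt0// lt_def N0 normr_ge0.
have [N _ hN] := (cvgrPdist_lt y p).1 yp _ e0.
have h1 := hN N (leqnn N); have h2 := hN N.+1 (leqnSn N).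
have : `|F p - p| < `|F p - p|; last by rewrite ltxx.
apply: le_lt_trans (ler_distD (y N.+1) _ _) _.
rewrite [ltRHS]splitr ler_ltD//; last by rewrite distrC.
apply: le_trans (ctrF _ _) _.
apply: le_trans (_ : `|p - y N| <= _); last exact: ltW.
by rewrite ler_piMl// invf_le1// ler1n.
Qed.

Lemma bounded_operator_gt0 (R : realType) (H : normedModType R[i])
    (T : H -> H) :
  bounded_operator T -> exists2 M : R[i], 0 < M & forall x, `|T x| <= M * `|x|.
Proof.
(* The given [M] may fail to be positive when [H] is zero or [T] vanishes; [|M| + 1] is positive. *)
move=> [M hM]; exists (`|M| + 1); first by rewrite ltr_wpDl.
move=> x; apply: le_trans (_ : `|M| * `|x| <= _); last first.
  by rewrite ler_wpM2r// lerDl.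
rewrite -[X in _ * X]normr_id -normrM ger0_norm//.
exact: le_trans (hM x).
Qed.

Section Resolvent.
Variables (R : realType) (H : completeNormedModType R[i]) (A : {linear H -> H}).
Variable M : R[i].
Hypothesis M_gt0 : 0 < M.
Hypothesis A_le : forall x, `|A x| <= M * `|x|.
Variable z : R[i].
Hypothesis z_ge : M *+ 2 <= `|z|.

Let z_gt0 : 0 < `|z|.
Proof. by apply: lt_le_trans z_ge; rewrite pmulrn_lgt0. Qed.

(** By [z_ge], [A x] has at most half the norm of [z *: x]. This yields both injectivity of the
    shift and the bound 2/|z| on its inverse. *)
Lemma shift_lower_bound x : `|z| * `|x| <= `|A x - z *: x| *+ 2.
Proof.
have h : `|z| * `|x| <= `|A x - z *: x| + M * `|x|.
  rewrite -normrZ.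
  have -> : `|z *: x| = `|A x - (A x - z *: x)| by rewrite subKr.
  by rewrite (le_trans (ler_normB _ _))// addrC lerD.
have h2 : M *+ 2 * `|x| <= `|z| * `|x| by rewrite ler_wpM2r.
rewrite -(lerD2r (`|z| * `|x|)).
apply: le_trans (lerD h h) _.
by rewrite addrACA -!mulr2n -mulrnAl lerD2l.
Qed.

Lemma bounded_inverse_shift : bounded_inverse (fun x => A x - z *: x) !=set0.
Proof.
have z0 : z != 0 by rewrite -normr_gt0.
have surj y : exists x, A x - z *: x = y.
  (* A solution of A x - z x = y is a fixed point of this map, whose Lipschitz constant M/|z| is at
     most 1/2. *)
  have [|p hp] := @contraction_fixpoint _ H (fun x => z^-1 *: (A x - y)).
    move=> x x'; rewrite -scalerBr opprB addrA subrK -linearB normrZ normfV.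
    rewrite ler_pdivrMl// (le_trans (A_le _))// mulrA ler_wpM2r//.
    by rewrite ler_pdivlMr// mulr_natr.
  by exists p; rewrite -[in z *: p]hp scalerA divff// scale1r subKr.
have /choice[S hS] := surj.
exists S; split.
- exists (2 / `|z|) => y; have := shift_lower_bound (S y).
  by rewrite hS -mulrA mulrCA ler_pdivlMl// mulr_natl.
- move=> x; apply/eqP; rewrite -subr_eq0 -normr_le0 -(pmulr_rle0 _ z_gt0).
  have := shift_lower_bound (S (A x - z *: x) - x).
  rewrite linearB scalerBr opprD addrACA -opprD hS subrr normr0 mul0rn.
  by [].
- by move=> y; rewrite hS.
Qed.

Lemma resolventP : bounded_inverse (fun x => A x - z *: x) (resolvent A z).
Proof.
by case: bounded_inverse_shift => S hS; exact: xgetPex _ (ex_intro _ S hS).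
Qed.

Lemma resolventK y : A (resolvent A z y) - z *: resolvent A z y = y.
Proof. by case: resolventP => _ _; exact. Qed.

Lemma resolvent_le y : `|resolvent A z y| * `|z| <= `|y| *+ 2.
Proof.
by have := shift_lower_bound (resolvent A z y); rewrite resolventK mulrC.
Qed.

End Resolvent.

(** * Cauchy-Schwarz, density of the span, uniqueness of adjoints *)

Section HilbertSpace.
Variables (R : realType) (H : normedModType R[i]) (dot : {dot H for Num.conj}).
Hypothesis hdot : hilbert_norm dot.

Lemma dot_conjC x y : dot x y = (dot y x)^*.
Proof. by rewrite hermC /= expr0 mul1r. Qed.

(** Cauchy-Schwarz: the squared norm of (y,y)x - (x,y)y factors as (y,y) times (x,x)(y,y) -
    |(x,y)|^2. *)
Lemma norm_dot_le x y : `|dot x y| <= `|x| * `|y|.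
Proof.
have [->|y0] := eqVneq y 0; first by rewrite linear0r !normr0 mulr0.
have yy0 : 0 < dot y y by rewrite dnorm_gt0.
have q_real : (dot y y)^* = dot y y by rewrite -dot_conjC.
have : 0 <= dot (dot y y *: x - dot x y *: y) (dot y y *: x - dot x y *: y).
  exact: dnorm_ge0.
rewrite dnormB !dnormZ linearZl_LR linearZr_LR /= !rmorphM /= conjCK -dot_conjC.
have -> : dot y x * dot x y = `|dot x y| ^+ 2.
  by rewrite normCK -dot_conjC mulrC.
have -> : dot x y * dot y x = `|dot x y| ^+ 2 by rewrite normCK -dot_conjC.
rewrite q_real (ger0_norm (ltW yy0)).
have -> : dot y y ^+ 2 * dot x x + `|dot x y| ^+ 2 * dot y y -
    (dot y y * `|dot x y| ^+ 2 + dot y y * `|dot x y| ^+ 2) =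
    dot y y * (dot x x * dot y y - `|dot x y| ^+ 2) by ring.
rewrite pmulr_rge0// subr_ge0 -!hdot -exprMn.
by rewrite ler_pXn2r ?nnegrE ?mulr_ge0.
Qed.

Section Density.
Variables (N : option nat) (e : nat -> H).
Hypothesis e_dense : closure (finite_span N e) = setT.

Lemma eq0_on_basis (L : H -> R[i]) (C : R[i]) :
  (forall c x y, L (c *: x + y) = c * L x + L y) ->
  (forall x, `|L x| <= C * `|x|) ->
  (forall k, index_lt N k -> L (e k) = 0) -> forall x, L x = 0.
Proof.
move=> Llin Lle Le x; apply/eqP/negPn/negP => Lx0.
have L0 : L 0 = 0.
  by apply/eqP; rewrite -normr_le0 (le_trans (Lle _))// normr0 mulr0.
have x_pos : 0 < `|x|.
  by rewrite normr_gt0; apply: contraNneq Lx0 => ->; apply/eqP.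
have C_gt0 : 0 < C.
  by rewrite -(pmulr_lgt0 _ x_pos) (lt_le_trans _ (Lle x))// normr_gt0.
have : closure (finite_span N e) x by rewrite e_dense.
(* A point of the span within this radius of [x] would give |L x| < |L x|, since [L] vanishes on the
   span. *)
have r0 : 0 < `|L x| / C by rewrite divr_gt0// normr_gt0.
move=> /(_ _ (nbhsx_ballx x _ r0)) [y [[m [c ->]]]].
rewrite -ball_normE /= => hxy.
have Ls : L (\sum_(k < m | index_lt N k) c k *: e k) = 0.
  elim/big_rec: _ => // k y' Nk IH.
  by rewrite Llin IH Le// mulr0 addr0.
have : `|L x| < `|L x|; last by rewrite ltxx.
rewrite -[X in `|X| < _]subr0 -Ls -[- L _]mulN1r addrC -Llin scaleN1r addrC.
by apply: le_lt_trans (Lle _) _; rewrite mulrC -ltr_pdivlMr.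
Qed.

Lemma eq0_orthogonal_basis x :
  (forall k, index_lt N k -> dot x (e k) = 0) -> x = 0.
Proof.
move=> xe; apply/eqP; rewrite -(dnorm_eq0 dot).
have := @eq0_on_basis (dot^~ x) `|x| _ _ _ x => ->//.
- by move=> c u v; rewrite linearPl.
- by move=> u; rewrite mulrC norm_dot_le.
- by move=> k Nk; rewrite dot_conjC xe// rmorph0.
Qed.

(** Density is used once per argument; conjugating [B x] makes it linear in the second one. *)
Lemma dot_eq0_basis (B : H -> H -> R[i]) (C : R[i]) :
  (forall c x x' y, B (c *: x + x') y = c * B x y + B x' y) ->
  (forall c x y y', B x (c *: y + y') = c^* * B x y + B x y') ->
  (forall x y, `|B x y| <= C * `|x| * `|y|) ->
  (forall j k, index_lt N j -> index_lt N k -> B (e k) (e j) = 0) ->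
  forall x y, B x y = 0.
Proof.
move=> Bl Br Ble Be x y.
suff H1 j : index_lt N j -> forall x', B x' (e j) = 0.
  apply/eqP; rewrite -conjC_eq0; apply/eqP.
  apply: (@eq0_on_basis (fun y => (B x y)^*) (C * `|x|)).
  - by move=> c u v; rewrite Br rmorphD rmorphM /= conjCK.
  - by move=> u; rewrite norm_conjC.
  - by move=> k Nk; rewrite H1// rmorph0.
move=> Nj; apply: (@eq0_on_basis _ (C * `|e j|)).
- by move=> c u v; rewrite Bl.
- by move=> u; rewrite mulrAC.
- by move=> k Nk; exact: Be.
Qed.

End Density.

(** The witness [S] rules out the default value of [xget], and two adjoints differ at [y] by a
    vector orthogonal to itself. *)
Lemma adjointP (T S : H -> H) :
  (forall x y, dot (T x) y = dot x (S y)) -> adjoint dot T = S.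
Proof.
move=> TS; apply/funext => y; apply/eqP; rewrite -subr_eq0 -(dnorm_eq0 dot).
have : [set S' | forall x y, dot (T x) y = dot x (S' y)] (adjoint dot T).
  exact: xgetPex _ (ex_intro _ S TS).
by move=> /= TS'; rewrite linearBr /= -TS -TS' subrr.
Qed.

End HilbertSpace.

(** * From the operator to the recurrence of its matrix *)

Lemma index_ltW N k : index_lt N k.+1 -> index_lt N k.
Proof. by case: N => //= n /ltnW. Qed.

Section JacobiOperator.
Variables (R : realType) (H : completeNormedModType R[i]).
Variables (dot : {dot H for Num.conj}) (A : {linear H -> H}).
Variables (N : option nat) (b a : nat -> R[i]) (e : nat -> H).
Hypothesis hdot : hilbert_norm dot.
Hypothesis e_basis : orthonormal_basis N dot e.
Hypothesis A_matrix : is_matrix_of N dot A e (jacobi_entry b a).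
Variable M : R[i].
Hypothesis M_gt0 : 0 < M.
Hypothesis A_le : forall x, `|A x| <= M * `|x|.

(** Extension by 0 matters for finite matrices, where [e k] is arbitrary outside the index set and
    the last row still mentions a right neighbour. *)
Definition basis_coef (x : H) (k : nat) : R[i] :=
  if index_lt N k then dot x (e k) else 0.

Lemma basis_coef_lin c x y k :
  basis_coef (c *: x + y) k = c * basis_coef x k + basis_coef y k.
Proof. by rewrite /basis_coef; case: ifP; rewrite ?linearPl// mulr0 addr0. Qed.

Lemma basis_coef_le x k : `|basis_coef x k| <= `|e k| * `|x|.
Proof.
rewrite /basis_coef; case: ifP => _; first by rewrite mulrC norm_dot_le.
by rewrite normr0 mulr_ge0.
Qed.

Lemma basis_coef_delta j k : index_lt N k -> basis_coef (e k) j = (j == k)%:R.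
Proof.
move=> Nk; rewrite /basis_coef; case: ifP => Nj.
  by rewrite e_basis.1// eq_sym.
by case: eqVneq Nk => // <-; rewrite Nj.
Qed.

(** Both sides are bounded and linear in [x], so density reduces the claim to basis vectors, where
    it is the matrix hypothesis. *)
Lemma basis_coef_jacobi x j : index_lt N j ->
  dot (A x) (e j) = jacobi_row b a (basis_coef x) j.
Proof.
move=> Nj; apply/eqP; rewrite -subr_eq0; apply/eqP.
pose C := M * `|e j| + ((if j is i.+1 then `|a i| * `|e i| else 0) +
           `|b j| * `|e j| + `|a j| * `|e j.+1|).
apply: (eq0_on_basis e_basis.2 (L := fun x => dot (A x) (e j) -
          jacobi_row b a (basis_coef x) j) (C := C)).
- move=> c y y'; rewrite linearP linearPl /jacobi_row /= !basis_coef_lin.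
  by case: (j) => [|i]; rewrite ?basis_coef_lin; ring.
- move=> y; apply: le_trans (ler_normB _ _) _; rewrite [C * _]mulrDl.
  apply: lerD.
    apply: le_trans (norm_dot_le hdot _ _) _.
    by rewrite mulrAC ler_wpM2r.
  rewrite /jacobi_row !mulrDl.
  do 2?[apply: le_trans (ler_normD _ _) _; apply: lerD].
  + case: (j) => [|i]; first by rewrite normr0 mul0r.
    by rewrite normrM -mulrA ler_wpM2l// basis_coef_le.
  + by rewrite normrM -mulrA ler_wpM2l// basis_coef_le.
  + by rewrite normrM -mulrA ler_wpM2l// basis_coef_le.
- move=> k Nk; rewrite A_matrix// /jacobi_row /jacobi_entry.
  rewrite !basis_coef_delta//.
  case: j {C} Nj => [|i] Nj; rewrite ?basis_coef_delta//.
    case: k Nk => [|[|k]] Nk /=; ring.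
  rewrite eqSS; have [<-|ki1] := eqVneq i.+1 k.
    by rewrite (ltn_eqF (ltnSn i)) (gtn_eqF (ltnSn i.+1)) /=; ring.
  have [->|ki2] := eqVneq k i.+2.
    by rewrite (ltn_eqF (ltnW (ltnSn i.+1))) /=; ring.
  by case: eqVneq => [->|_] /=; ring.
Qed.

(* A has a symmetric matrix whose only nonreal entry is b_0, so the adjoint is
   explicit and the Riesz theorem is not needed. *)
Lemma jacobi_adjoint : jacobi_admissible N b a ->
  adjoint dot A =
  (fun y => A y - ((b 0%N - (b 0%N)^*) * dot y (e 0%N)) *: e 0%N).
Proof.
move=> [_ b_real a_pos]; apply: adjointP => x y.
have [d dE] : exists d, d = b 0%N - (b 0%N)^* by eexists.
have dC : d^* = - d by rewrite dE rmorphB /= conjCK opprB.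
rewrite -dE.
have -> : dot x (A y - (d * dot y (e 0%N)) *: e 0%N) =
          dot x (A y) + d * dot x (e 0%N) * dot (e 0%N) y.
  rewrite linearBr /= linearZr_LR /= rmorphM /= dC -dot_conjC; ring.
apply/eqP; rewrite -subr_eq0; apply/eqP.
apply: (dot_eq0_basis e_basis.2 (B := fun x y => dot (A x) y -
   (dot x (A y) + d * dot x (e 0%N) * dot (e 0%N) y))
   (C := M + M + `|d| * `|e 0%N| ^+ 2)).
- by move=> c x1 x2 y1; rewrite linearP !linearPl /=; ring.
- move=> c x1 y1 y2; rewrite [A (_ + _)]linearP !linearPr /=.
  by rewrite -[c^* *: _]/(c^* * _); ring.
- move=> x1 y1; apply: le_trans (ler_normB _ _) _.
  rewrite !mulrDl -addrA; apply: lerD.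
    by apply: le_trans (norm_dot_le hdot _ _) _; rewrite ler_wpM2r.
  apply: le_trans (ler_normD _ _) _; apply: lerD.
    apply: le_trans (norm_dot_le hdot _ _) _.
    by rewrite mulrC mulrAC ler_wpM2r.
  have -> : `|d| * `|e 0%N| ^+ 2 * `|x1| * `|y1| =
    `|d| * ((`|x1| * `|e 0%N|) * (`|e 0%N| * `|y1|)) by ring.
  rewrite !normrM -mulrA ler_wpM2l//.
  by apply: ler_pM => //; exact: norm_dot_le.
move=> j k Nj Nk; have N0 : index_lt N 0.
  by case: (N) Nj => //= n; apply: leq_ltn_trans.
rewrite (dot_conjC dot (e k)) !A_matrix// !e_basis.1// /jacobi_entry.
have [->|jk] := eqVneq j k.
  have [->|k0] := eqVneq k 0%N; first by rewrite dE /=; ring.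
  by rewrite conj_Creal ?b_real// ?lt0n//=; ring.
have aC i : index_lt N i.+1 -> (a i)^* = a i.
  by move=> Ni; rewrite conj_Creal// gtr0_real// a_pos.
(* The correction term sits only at position (0,0), and here the two indices differ. *)
have -> : d * (k == 0%N)%:R * (0%N == j)%:R = 0.
  by case: k {Nk} jk => [|k] jk; rewrite /= ?(eq_sym 0%N) ?(negPf jk) /=; ring.
have [kj|_] := eqVneq k j.+1.
  by move: kj Nk {jk} => -> Nk;
    rewrite (ltn_eqF (ltnW (ltnSn j.+1))) aC//; ring.
have [jk1|_] := eqVneq j k.+1; last by rewrite conjC0; ring.
by rewrite aC -?jk1//; ring.
Qed.

Lemma jacobi_resolvent_basis_coef (g : H) (c : R[i]) (z : nat -> R[i]) :
  g = c *: e 0%N -> index_lt N 0 -> (forall n, M *+ 2 <= `|z n|) ->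
  jacobi_resolvent (index_lt N) b a c z
    (fun j n => basis_coef (resolvent A (z n) g) j).
Proof.
move=> gE N0 zM; split=> j n Nj; last by rewrite /basis_coef (negPf Nj).
have /(canRL (subrK _)) Af := resolventK M_gt0 A_le (zM n) g.
rewrite -basis_coef_jacobi// Af linearDl /= linearZl_LR /= {2}gE linearZl_LR /=.
by rewrite e_basis.1// /basis_coef Nj addrC mulrC [0%N == _]eq_sym; ring.
Qed.

Lemma basis_coef_resolvent_bigO (g : H) (z : nat -> R[i]) (j : nat) :
  (forall n, M *+ 2 <= `|z n|) ->
  inv_bigO z 1 (fun n => basis_coef (resolvent A (z n) g) j).
Proof.
move=> zM; exists (`|e j| * (`|g| *+ 2)) => n.
rewrite normrM expr1; apply: le_trans (ler_wpM2r _ (basis_coef_le _ _)) _ => //.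
by rewrite -mulrA ler_wpM2l// (resolvent_le M_gt0 A_le).
Qed.

(** The explicit adjoint turns the channel equation into [key]. Taking [h] to be [g] shows that [g]
    is a multiple of the first basis vector; taking [h] to be that vector gives |c|^2. *)
Lemma jacobi_channel (g : H) : jacobi_admissible N b a -> index_lt N 0 ->
  channel_vector dot A g ->
  exists2 c, g = c *: e 0%N & c != 0 /\ 'i * (c * c^*) = b 0%N - (b 0%N)^*.
Proof.
move=> adm N0 hg; have ee : dot (e 0%N) (e 0%N) = 1 by rewrite e_basis.1.
pose d := b 0%N - (b 0%N)^*.
have key h : ('i^-1 * d * dot h (e 0%N)) *: e 0%N = dot h g *: g.
  rewrite -hg /imaginary_part jacobi_adjoint// subKr !scalerA; congr (_ *: _).
  by rewrite invfM !mulrA divff ?mul1r// pnatr_eq0.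
have d0 : d != 0.
  rewrite /d; case: adm => im _ _; apply: contraTneq im.
  move/subr0_eq => bC; suff -> : 'Im (b 0%N) = 0 by rewrite ltxx.
  by rewrite ImE -bC subrr mulr0 mul0r.
have g0 : g != 0.
  apply: contra_neq d0 => g0; have := key (e 0%N).
  rewrite g0 scaler0 ee mulr1 => /eqP; rewrite scaler_eq0 mulf_eq0 invr_eq0.
  rewrite (negPf (neq0Ci _)) /= => /orP[/eqP//|/eqP e0].
  by move: ee; rewrite e0 linear0l => /eqP; rewrite eq_sym oner_eq0.
have gg0 : dot g g != 0 by rewrite dnorm_eq0.
have [c gE] : exists c, g = c *: e 0%N.
  exists ((dot g g)^-1 * ('i^-1 * d * dot g (e 0%N))).
  by rewrite -scalerA key scalerA mulVf ?scale1r.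
exists c => //; split.
  by apply: contraNneq g0 => c0; rewrite gE c0 scale0r.
have dE : 'i^-1 * d = c^* * c.
  have := key (e 0%N); rewrite ee mulr1 [in RHS]gE.
  rewrite linearZr_LR /= ee mulr1 scalerA.
  by move/(congr1 (dot (e 0%N))); rewrite !linearZr_LR /= ee !mulr1;
    move/(inv_inj conjCK).
by rewrite [c * _]mulrC -dE mulVKf// neq0Ci.
Qed.

End JacobiOperator.

Theorem theorem6p4 (R : realType) (H : completeNormedModType R[i])
  (dot : {dot H for Num.conj}) (hdot : hilbert_norm dot)
  (hsep : separable_space H)
  (A : {linear H -> H}) (hA : bounded_operator A)
  (hdiss : dissipative dot A)
  (hrank : rank_one (imaginary_part dot A))
  (hprime : prime_operator dot A)
  (g : H) (hg : channel_vector dot A g)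
  (hW : forall z : R[i], ((operator_norm A)%:C%C < `|z|) ->
     characteristic_function dot A g (- z) =
     1 / characteristic_function dot A g z)
  (N : option nat) (b a : nat -> R[i])
  (hJ : jacobi_corresponds N dot A b a) :
  'Re (b 0%N) = 0 /\ (forall k, (0 < k)%N -> index_lt N k -> b k = 0).
Proof.
have [M M0 A_le] := bounded_operator_gt0 hA.
have [_ adm [e e_basis A_matrix]] := hJ.
(* Without index 0 there is no index at all, so the basis is empty and [H] is zero, against rank
   one. *)
have N0 : index_lt N 0.
  apply/negPn/negP => nN0; have [x x0 _] := hrank.
  move/eqP: x0; apply; apply: (eq0_orthogonal_basis hdot e_basis.2) => k Nk.
  by exfalso; move: nN0; rewrite (_ : index_lt N 0)//;
    elim: k Nk => // k IH /index_ltW.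
have [c gE [c0 cE]] := jacobi_channel hdot e_basis A_matrix A_le adm N0 hg.
(* The summands secure in turn the resolvent at both signs of [z n], the range of [hW], [W_neq0],
   and |z n| >= 1. *)
pose r : R[i] := M *+ 2 + `|(operator_norm A)%:C%C| + `|g| ^+ 2 *+ 2 + 1.
have M2_ge0 : 0 <= M *+ 2 by rewrite mulrn_wge0 ?ltW.
have g2_ge0 : 0 <= `|g| ^+ 2 *+ 2 by rewrite mulrn_wge0 ?exprn_ge0.
have [rM rA rg r1] : [/\ M *+ 2 <= r, `|(operator_norm A)%:C%C| <= r,
    `|g| ^+ 2 *+ 2 <= r & 1 <= r].
  rewrite /r; split.
  - by do 3!apply: ler_wpDr => //.
  - by do 2!apply: ler_wpDr => //; rewrite lerDr.
  - by apply: ler_wpDr => //; rewrite lerDr addr_ge0.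
  - by rewrite lerDr; do 2!apply: addr_ge0 => //.
have [n0 hn0] := complex_lt_nat (le_trans ler01 r1).
pose z n : R[i] := (n0 + n)%:R.
have z_gt n : r < `|z n|.
  by rewrite ger0_norm ?ler0n// (lt_le_trans hn0)// ler_nat leq_addr.
have z_ge1 n : 1 <= `|z n| := le_trans r1 (ltW (z_gt n)).
have zM n : M *+ 2 <= `|z n| := le_trans rM (ltW (z_gt n)).
have zNM n : M *+ 2 <= `|- z n| by rewrite normrN.
have zA n : (operator_norm A)%:C%C < `|z n|.
  apply: le_lt_trans (z_gt n); apply: le_trans rA.
  by apply: real_ler_norm; rewrite complex_real.
have z_unbounded (C : R[i]) : 0 <= C -> exists n, C < `|z n|.
  move=> C_ge0; have [n hn] := complex_lt_nat C_ge0; exists n.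
  by rewrite ger0_norm ?ler0n// (lt_le_trans hn)// ler_nat leq_addl.
pose u j n := basis_coef dot N e (resolvent A (z n) g) j.
pose v j n := basis_coef dot N e (resolvent A (- z n) g) j.
have W_u y : characteristic_function dot A g y =
    1 - 'i * (c^* * basis_coef dot N e (resolvent A y g) 0).
  by rewrite /characteristic_function {2}gE linearZr_LR /basis_coef N0.
(* Since 1 / 0 is 0 here, [hW] yields W(z)W(-z) = 1 only once W(z) is nonzero. The resolvent bound
   2|g|/|z| puts the subtracted term below 1 in modulus. *)
have W_neq0 n : characteristic_function dot A g (z n) != 0.
  rewrite /characteristic_function subr_eq0; apply/negP => /eqP W1.
  have : `|1 : R[i]| < 1; last by rewrite normr1 ltxx.
  rewrite {1}W1 normrM normCi mul1r.
  have zn0 : 0 < `|z n| := lt_le_trans ltr01 (z_ge1 n).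
  apply: le_lt_trans (norm_dot_le hdot _ _) _.
  rewrite -(ltr_pM2r zn0) mul1r mulrAC.
  apply: le_lt_trans (ler_wpM2r (normr_ge0 _)
    (resolvent_le M0 A_le (zM n) g)) _.
  by rewrite mulrnAl -expr2; exact: le_lt_trans rg (z_gt n).
have uv n : c * (u 0%N n + v 0%N n) =
    (b 0%N - (b 0%N)^*) * (u 0%N n * v 0%N n).
  have := hW (z n) (zA n); rewrite div1r => WV.
  have := mulVf (W_neq0 n); rewrite -WV !W_u -/(u 0%N n) -/(v 0%N n) -cE => W1.
  (* With k = i conj(c), expanding (1 - k u_0)(1 - k v_0) = 1 and dividing by k gives u_0 + v_0 = k
     u_0 v_0. *)
  have cc0 : 'i * c^* != 0 by rewrite mulf_neq0 ?neq0Ci// conjC_eq0.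
  have uvE : u 0%N n + v 0%N n = 'i * c^* * (u 0%N n * v 0%N n).
    apply: (mulfI cc0); apply/eqP; rewrite -subr_eq0; apply/eqP.
    by rewrite -[RHS](subrr (1 : R[i])) -[in X in _ = _ - X]W1; ring.
  by rewrite uvE; ring.
have a_neq0 j : index_lt N j.+1 -> a j != 0.
  by case: adm => _ _ a_pos /a_pos; exact: lt0r_neq0.
have v_O1 j : inv_bigO z 1 (v j).
  exact: inv_bigON (basis_coef_resolvent_bigO N e hdot M0 A_le g j zNM).
have [b0 bk] := jacobi_odd_diag (@index_ltW N) a_neq0 c0 z_ge1 z_unbounded
  (jacobi_resolvent_basis_coef hdot e_basis A_matrix M0 A_le gE N0 zM)
  (jacobi_resolvent_basis_coef hdot e_basis A_matrix M0 A_le gE N0 zNM)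
  (fun j => basis_coef_resolvent_bigO N e hdot M0 A_le g j zM) v_O1 uv.
split=> //; move/eqP: (b0 N0); rewrite mulr2n -subr_eq0 opprB.
by rewrite addrACA subrr addr0 ReE => /eqP->; rewrite mul0r.
Qed.
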